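(* Let $n\ge1$ and consider the Hamiltonian system $(\mathbb{R}^{2n},\omega_{\mathrm{std}},H)$ with coordinates $(x,y)=(x^1,\dots,x^n,y_1,\dots,y_n)$, $\omega_{\mathrm{std}}=\sum_{j=1}^n\mathrm dx^j\wedge\mathrm dy_j$ and $H\colon\mathbb{R}^{2n}\to\mathbb{R}$ smooth. Suppose that there is $p\in\mathbb{R}$, $p\neq1$, such that $H(x,\lambda y)=\lambda^pH(x,y)$ for all $(x,y)\in\mathbb{R}^{2n}$ and all $\lambda>0$, and that $\nabla_yH(x,y)\neq0$ whenever $y\neq0$. Let $\phi$ be the Hamiltonian time-1-map and $\phi^X=x\circ\phi$ its $x$-component. Then $$\dim\ker D_y\phi^X(x,y)\le n-1$$ at every point $(x,y)$ of the domain of $\phi$ that is not mapped by $\phi$ to the subspace $\{y=0\}$.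
   Context: The Hamiltonian vector field $X_H$ is defined by $\mathrm dH=\iota_{X_H}\omega_{\mathrm{std}}$, and $\phi$ is its flow map at time $1$, defined on the open set of points where the flow exists up to time $1$. $D_y\phi^X$ denotes the $n\times n$ Jacobian matrix of $\phi^X$ with respect to the $y$-variables. *)

(* Defs.v *)
From HB Require Import structures.
From mathcomp Require Export all_boot all_order all_algebra.
From mathcomp Require Export all_classical all_reals all_analysis.

Set Implicit Arguments.
Unset Strict Implicit.
Unset Printing Implicit Defensive.

Import Order.TTheory GRing.Theory Num.Theory.
Export numFieldNormedType.Exports.

Local Open Scope classical_set_scope.
Local Open Scope ring_scope.

(* R^{2n}; a point is a pair (x, y), with x = z.1 and y = z.2. *)
Notation phase_space R n := ('rV[R]_n * 'rV[R]_n)%type.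

(* For a finite-dimensional V this is the usual class C^k: f is C^(k+1) iff it
   is differentiable and its derivatives in all (equivalently, in all
   coordinate) directions are C^k. *)
Fixpoint Ck (R : realType) (V : normedModType R) (k : nat) (f : V -> R) : Prop :=
  match k with
  | 0 => continuous f
  | k'.+1 => (forall z, differentiable f z) /\ forall v, Ck k' ('D_v f)
  end.

Definition smooth (R : realType) (V : normedModType R) (f : V -> R) : Prop :=
  forall k, Ck k f.

(* dx^j /\ dy_j evaluated on (u, v) is dx^j(u) dy_j(v) - dy_j(u) dx^j(v). *)
Definition omega_std (R : realType) (n : nat) (u v : phase_space R n) : R :=
  \sum_(j < n) (u.1 0 j * v.2 0 j - u.2 0 j * v.1 0 j).

(* dH = iota_X omega_std; since omega_std is nondegenerate, X is determined
   by H. *)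
Definition is_hamiltonian_vector_field (R : realType) (n : nat)
    (H : phase_space R n -> R) (X : phase_space R n -> phase_space R n) : Prop :=
  forall z v, 'd H z v = omega_std (X z) v.

Definition gradient_y (R : realType) (n : nat) (H : phase_space R n -> R)
    (x y : 'rV[R]_n) : 'rV[R]_n :=
  \row_j 'D_(delta_mx 0 j) (fun y' => H (x, y')) y.

Definition integral_curve (R : realType) (V : normedModType R) (X : V -> V)
    (a b : R) (c : R -> V) : Prop :=
  forall t : R, t \in `]a, b[ -> is_derive t (1 : R) c (X (c t)).

(* The integral curve of X starting at z exists up to time t, on an open time
   interval, and is at w at that time. *)
Definition flows_to (R : realType) (V : normedModType R) (X : V -> V) (t : R)
    (z w : V) : Prop :=
  exists (a b : R) (c : R -> V),
    [/\ 0 \in `]a, b[, t \in `]a, b[, integral_curve X a b c, c 0 = z & c t = w].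

Definition flow_domain (R : realType) (V : normedModType R) (X : V -> V)
    (t : R) : set V :=
  [set z | exists w, flows_to X t z w].

(* Outside flow_domain X t the value is a dummy; for smooth X the domain is
   open, so derivatives at its points do not depend on it. *)
Definition flow (R : realType) (V : normedModType R) (X : V -> V) (t : R)
    (z : V) : V :=
  xget z (flows_to X t z).

(* The library's Jacobian 'J f y acts on row vectors from the right,
   v |-> v *m 'J f y, so that its row kernel kermx is the kernel of the
   differential. *)
Definition jacobian_y (R : realType) (n : nat)
    (f : phase_space R n -> 'rV[R]_n) (x y : 'rV[R]_n) : 'M[R]_n :=
  'J (fun y' : 'rV[R]_n => f (x, y')) y.

Definition dim_ker (R : realType) (n : nat) (A : 'M[R]_n) : nat :=
  \rank (kermx A).

(* Main.v *)
(* If c is an integral curve and k > 0, homogeneity makes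
   t |-> (x (k^(p-1) t), k y (k^(p-1) t)) one too.  Hence, as k varies,
   phi^X (x, k y) runs along the x-component of the single curve c, and its
   derivative at k = 1, which is D_y phi^X (x, y) applied to y, equals
   (p - 1) grad_y H (phi (x, y)) <> 0.  So D_y phi^X is not the zero matrix.

   Since the library's Jacobian is only meaningful for differentiable maps, one
   also needs the flow to be differentiable in the initial condition.  Nearby
   solutions come from Picard iteration for the vector field frozen outside a
   large ball, and Gronwall's inequality compares their deviation from c with
   the solution of the variational equation up to a quadratic error. *)
Require Import Defs.
From mathcomp Require Import ring lra.

Set Implicit Arguments.
Unset Strict Implicit.
Unset Printing Implicit Defensive.

Import Order.TTheory GRing.Theory Num.Theory.

Local Open Scope classical_set_scope.
Local Open Scope ring_scope.

(** * Mean value estimates for curves *)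

(** Pulling back by [fiber_scale k] multiplies [omega_std] by [k] and [H] by [k^p]; this is why the
    exponent [p - 1] governs both the field and the change of time. One nonzero vector in the image
    of the Jacobian is enough, and nondegeneracy of [H] is applied at the end point, which is the
    point assumed to lie off [y = 0].

    The flow is an existential choice with no regularity attached, so its differentiability comes
    from estimates on curves alone, all resting on the comparison principle [fencing]. Existence is
    required for two different equations, the autonomous frozen one and the time-dependent linear
    variational one; a single Picard theorem for globally Lipschitz, time-dependent fields on the
    whole line covers both. The differential in [y] is assembled from the [n] variational solutions
    starting at the [y]-basis vectors: it is linear by construction, and the quadratic error bound
    identifies it. *)

Section time_derivative.
Variables (R : realType) (V : normedModType R).
Implicit Types f : R -> V.

(** The difference quotient multiplied out: [h = 0] is no exception, and derivatives of curves
    become pure norm estimates. *)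
Lemma is_derive1P f t v :
  is_derive t (1 : R) f v <-> forall e, 0 < e -> exists2 d, 0 < d &
    forall h, `|h| < d -> `|f (t + h) - f t - h *: v| <= e * `|h|.
Proof.
split=> [[fd fv] e e0|fP].
  have : (fun h => h^-1 *: ((f \o shift t) (h *: 1) - f t)) @ 0^' --> v.
    by rewrite -fv; exact: fd.
  move=> /cvgrPdist_le/(_ e e0)[d /= d0 dP].
  exists d => // h hd; have [->|h0] := eqVneq h 0.
    by rewrite addr0 subrr scale0r subrr !normr0 mulr0.
  have := dP h; rewrite /ball_ /= sub0r normrN => /(_ hd h0).
  rewrite [h *: 1]mulr1 [h + t]addrC => hP.
  have -> : f (t + h) - f t - h *: v = - (h *: (v - h^-1 *: (f (t + h) - f t))).
    by rewrite scalerBr scalerA mulfV// scale1r opprB.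
  by rewrite normrN normrZ mulrC ler_wpM2r.
have fv : (fun h => h^-1 *: ((f \o shift t) (h *: 1) - f t)) @ 0^' --> v.
  apply/cvgrPdist_le => e e0; have [d d0 dP] := fP e e0.
  exists d => //= h; rewrite /ball_ /= sub0r normrN => hd h0.
  rewrite [h *: 1]mulr1 [h + t]addrC.
  have -> : v - h^-1 *: (f (t + h) - f t) = - (h^-1 *: (f (t + h) - f t - h *: v)).
    by rewrite [in RHS]scalerBr scalerA mulVf// scale1r opprB.
  rewrite normrN normrZ normfV ler_pdivrMl ?normr_gt0//.
  by rewrite mulrC dP.
by split; [apply/cvg_ex; exists v | exact/cvg_lim].
Qed.

Lemma is_derive1_continuous f t v : is_derive t (1 : R) f v -> {for t, continuous f}.
Proof.
move=> [fv _]; apply: differentiable_continuous.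
exact: (derivable1_diffP _ _).1 fv.
Qed.

Lemma is_derive1_comp_scale f (k c t : R) v : is_derive (k * t + c) (1 : R) f v ->
  is_derive t (1 : R) (fun s => f (k * s + c)) (k *: v).
Proof.
move=> /is_derive1P fv; apply/is_derive1P => e e0.
(* Dividing by [|k| + 1] instead of [|k|] keeps [k = 0] in the same argument. *)
have k0 : 0 < `|k| + 1 by rewrite ltr_wpDl.
have [d d0 dP] := fv (e / (`|k| + 1)) (divr_gt0 e0 k0).
exists (d / (`|k| + 1)) => [|h hd]; first exact: divr_gt0.
have hk : `|k * h| <= (`|k| + 1) * `|h|.
  by rewrite normrM ler_wpM2r// lerDl.
have : `|k * h| < d.
  by apply: le_lt_trans hk _; rewrite mulrC -ltr_pdivlMr.
move=> /dP; have -> : k * t + c + k * h = k * (t + h) + c by ring.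
have -> : (k * h) *: v = h *: (k *: v) by rewrite scalerA mulrC.
move=> /le_trans; apply.
by rewrite -mulrA ler_pM2l// ler_pdivrMl//.
Qed.

End time_derivative.

(* If the norm of [f] ever exceeded [g], it would have crossed it at a last
   time, where the derivatives forbid a crossing. *)
Lemma fencing (R : realType) (V : normedModType R) (f f' : R -> V)
    (g dg : R -> R) (T : R) :
  (forall t, t \in `[0, T] -> is_derive t (1 : R) f (f' t)) ->
  (forall t, t \in `[0, T] -> is_derive t (1 : R) g (dg t)) ->
  `|f 0| <= g 0 ->
  (forall t, t \in `[0, T] -> `|f t| = g t -> `|f' t| < dg t) ->
  forall t, t \in `[0, T] -> `|f t| <= g t.
Proof.
move=> fd gd fg0 fgd t tT; rewrite leNgt; apply/negP => gft.
have /andP[t0 tT'] : (0 <= t) && (t <= T) by move: tT; rewrite in_itv.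
pose S := [set s | s \in `[0, t] /\ `|f s| <= g s].
have S0 : S 0 by split => //; rewrite in_itv/= lexx t0.
have supS : has_sup S.
  split; first by exists 0.
  by exists t => s [/itvP->].
pose s := sup S.
have s0 : 0 <= s by apply: ub_le_sup => //; case: supS.
have st : s <= t by apply: ge_sup; [case: supS | move=> r [/itvP->]].
have sT : s \in `[0, T] by rewrite in_itv/= s0 (le_trans st).
have fc := is_derive1_continuous (fd s sT).
have gc := is_derive1_continuous (gd s sT).
have phic : {for s, continuous (fun r => `|f r| - g r)}.
  by apply: cvgB; [apply: cvg_norm; exact: fc | exact: gc].
have phis : `|f s| - g s <= 0.
  rewrite leNgt; apply/negP => phi0.
  have /cvgrPdist_lt/(_ _ phi0)[d /= d0 dP] := phic.
  have [r Sr sr] := sup_adherent d0 supS.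
  have rs : r <= s by apply: ub_le_sup => //; case: supS.
  have := dP r; rewrite /ball_/= ger0_norm ?subr_ge0//.
  have sr' : s - r < d by rewrite ltrBlDl -ltrBlDr.
  move=> /(_ sr') /(le_lt_trans (ler_norm _)).
  by move=> ?; case: Sr => _ ?; lra.
have st' : s < t.
  rewrite lt_neqAle st andbT; apply/eqP => ste.
  by move: phis; rewrite ste leNgt subr_gt0 gft.
have phi_gt r : s < r -> r <= t -> g r < `|f r|.
  move=> sr rt; rewrite ltNge; apply/negP => fr.
  have : r <= s.
    apply: ub_le_sup; [by case: supS | split=> //].
    by rewrite in_itv/= rt (le_trans s0 (ltW sr)).
  by rewrite leNgt sr.
(* A strict inequality at [s] would persist slightly beyond [s], against the choice of the
   supremum. *)
have phis0 : `|f s| = g s.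
  apply/eqP; rewrite -subr_eq0 eq_le phis/= leNgt; apply/negP => phi0.
  rewrite -oppr_gt0 in phi0.
  have /cvgrPdist_lt/(_ _ phi0)[d /= d0 dP] := phic.
  have m0 : 0 < Num.min (d / 2) (t - s) by rewrite lt_min divr_gt0//= subr_gt0.
  have := dP (s + Num.min (d / 2) (t - s)).
  rewrite /ball_/= opprD addNKr normrN gtr0_norm// => dP'.
  have /dP' : Num.min (d / 2) (t - s) < d.
    by rewrite gt_min ltr_pdivrMr// ltr_pMr// ltr1n.
  rewrite distrC => /(le_lt_trans (ler_norm _)); rewrite ltrBlDr addNr subr_lt0.
  apply/negP; rewrite -leNgt ltW// phi_gt ?ltrDl//.
  by rewrite -lerBrDl ge_min lexx orbT.
have := fgd s sT phis0; rewrite -subr_gt0 => e0.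
(* With [e] half the gap, over a step [h] the norm of [f] gains at most [(|f' s| + e) * h] and [g]
   gains at least [(dg s - e) * h], the same amount. This contradicts [gsh]. *)
pose e := (dg s - `|f' s|) / 2.
have {}e0 : 0 < e by rewrite divr_gt0.
have [d1 d10 d1P] := (is_derive1P _ _ _).1 (fd s sT) _ e0.
have [d2 d20 d2P] := (is_derive1P _ _ _).1 (gd s sT) _ e0.
pose h := Num.min (Num.min (d1 / 2) (d2 / 2)) (t - s).
have h0 : 0 < h by rewrite !lt_min !divr_gt0//= subr_gt0.
have hd1 : h <= d1 / 2 by rewrite /h !ge_min lexx.
have hd2 : h <= d2 / 2 by rewrite /h !ge_min lexx orbT.
have hts : h <= t - s by rewrite /h !ge_min lexx orbT.
have nh : `|h| = h by rewrite gtr0_norm.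
have {}d1P := d1P h; have {}d2P := d2P h; rewrite nh in d1P d2P.
have {}d1P : `|f (s + h) - f s - h *: f' s| <= e * h by apply: d1P; lra.
have {}d2P : `|g (s + h) - g s - h * dg s| <= e * h by apply: d2P; lra.
have gsh : g (s + h) < `|f (s + h)| by apply: phi_gt; lra.
have : `|f (s + h)| <= `|f (s + h) - f s - h *: f' s| + `|f s| + h * `|f' s|.
  have -> : h * `|f' s| = `|h *: f' s| by rewrite normrZ nh.
  have {1}-> : f (s + h) = f (s + h) - f s - h *: f' s + f s + h *: f' s.
    by rewrite addrAC subrK subrK.
  by rewrite !(le_trans (ler_normD _ _))// lerD2r ler_normD.
move: d2P; rewrite ler_norml => /andP[d2P _].
move=> ?; have : e * h * 2 = (dg s - `|f' s|) * h by rewrite /e; field.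
lra.
Qed.

(** Linearity and a norm bound are passed as plain facts, so projections, coordinates and
    [fiber_scale k] qualify without being packaged as continuous linear maps. *)
Lemma is_derive1_linear (R : realType) (V W : normedModType R) (l : V -> W)
    (K : R) (f : R -> V) (t : R) (v : V) :
  (forall a b, l (a - b) = l a - l b) -> (forall k a, l (k *: a) = k *: l a) ->
  (forall a, `|l a| <= K * `|a|) ->
  is_derive t (1 : R) f v -> is_derive t (1 : R) (l \o f) (l v).
Proof.
move=> lB lZ lK /is_derive1P fv; apply/is_derive1P => e e0.
have k0 : 0 < `|K| + 1 by rewrite ltr_wpDl.
have [d d0 dP] := fv (e / (`|K| + 1)) (divr_gt0 e0 k0).
exists d => // h /dP hd /=; rewrite -lZ -!lB (le_trans (lK _))//.
apply: (@le_trans _ _ ((`|K| + 1) * (e / (`|K| + 1) * `|h|))).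
  apply: le_trans (ler_wpM2l _ hd); last exact: ltW.
  by rewrite ler_wpM2r// (le_trans (ler_norm K))// lerDl.
by rewrite [X in X <= _](_ : _ = e * `|h|) //; field; rewrite gt_eqF.
Qed.

Lemma is_derive_exp_scale (R : realType) (C M t : R) :
  is_derive t (1 : R) (fun s => C * expR (M * s)) (C * M * expR (M * t)).
Proof.
have e : is_derive (M * t + 0) (1 : R) expR (expR (M * t)).
  by rewrite addr0; exact: is_derive_expR.
rewrite (_ : (fun s => _) = C \*: (fun s => expR (M * s + 0))); last first.
  by apply/funext => s; rewrite -[RHS]/(C * expR (M * s + 0)) addr0.
apply: is_derive_eq (is_deriveZ C (is_derive1_comp_scale e)) _.
by rewrite -mulrA.
Qed.

Section estimates.
Variables (R : realType) (V : normedModType R).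
Implicit Types f : R -> V.

(** [fencing] asks for a strict inequality of derivatives, so [g] is made steeper by [e'], chosen so
    that the total excess up to time [T] is at most [e]. *)
Lemma mean_value_le f (f' : R -> V) (g dg : R -> R) (T : R) :
  (forall t, t \in `[0, T] -> is_derive t (1 : R) f (f' t)) ->
  (forall t, t \in `[0, T] -> is_derive t (1 : R) g (dg t)) ->
  (forall t, t \in `[0, T] -> `|f' t| <= dg t) ->
  forall t, t \in `[0, T] -> `|f t - f 0| <= g t - g 0.
Proof.
move=> fd gd fgd t tT; have /andP[t0 tT'] : 0 <= t <= T by rewrite in_itv in tT.
apply/ler_addgt0Pr => e e0.
have T1 : 0 < 1 + T by rewrite ltr_pwDl// (le_trans t0).
pose e' := e / (1 + T); have e'0 : 0 < e' by exact: divr_gt0.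
pose G (s : R) : R := g s - g 0 + e' * (1 + s).
apply: (@le_trans _ _ (G t)); last first.
  by rewrite /G lerD2l /e' mulrAC ler_pdivrMr// ler_pM2l// lerD2l.
pose F s := f s - f 0.
apply: (@fencing _ _ F f' G (fun s => dg s + e') T _ _ _ _ t tT) => [s sT|s sT||s sT _].
- apply: is_derive_eq (is_deriveB (fd s sT) (is_derive_cst (f 0) s 1)) _.
  by rewrite subr0.
- have := is_deriveD (gd s sT) (is_deriveD (is_derive_cst (- g 0 + e') s 1)
    (is_deriveZ e' (is_derive_id s (1 : R)))).
  have -> : (g + (cst (- g 0 + e') + e' \*: id)) = G.
    by apply/funext => r; rewrite /G -[LHS]/(g r + (- g 0 + e' + e' * r)); ring.
  by move=> Gd; apply: (is_derive_eq Gd); rewrite add0r [e' *: 1]mulr1.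
- by rewrite /F /G !subrr normr0 add0r addr0 mulr1 ltW.
- by rewrite (le_lt_trans (fgd s sT))// ltrDl.
Qed.

(** Integrating against the weight [expR (M * |t|)] gains a factor [1 / M]; this is the source of
    the contraction in Picard iteration. Negative times follow by reversing time. *)
Lemma mean_value_exp f (f' : R -> V) (C M : R) : 0 < M ->
  (forall t, is_derive t (1 : R) f (f' t)) ->
  (forall t, `|f' t| <= C * M * expR (M * `|t|)) ->
  forall t, `|f t - f 0| <= C * expR (M * `|t|) - C.
Proof.
move=> M0 fd fM.
have pos (h h' : R -> V) : (forall t, is_derive t (1 : R) h (h' t)) ->
  (forall t, `|h' t| <= C * M * expR (M * `|t|)) ->
  forall t, 0 <= t -> `|h t - h 0| <= C * expR (M * `|t|) - C.
  move=> hd hM t t0.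
  have := @mean_value_le h h' (fun s => C * expR (M * s))
    (fun s => C * M * expR (M * s)) t.
  rewrite mulr0 expR0 mulr1 ger0_norm//; apply => //.
  - by move=> s _; exact: is_derive_exp_scale.
  - by move=> s /itvP s0; apply: le_trans (hM s) _; rewrite ger0_norm ?s0.
  - by rewrite in_itv/= lexx t0.
move=> t; have [t0|t0] := leP 0 t; first exact: (pos f f').
have := pos (fun s => f (- 1 * s + 0)) (fun s => -1 *: f' (-1 * s + 0)) _ _ (- t).
rewrite mulrNN mul1r mulr0 !addr0 normrN; apply.
- by move=> s; apply: is_derive1_comp_scale; exact: fd.
- move=> s; rewrite normrZ normrN1 mul1r (le_trans (fM _))//.
  by rewrite mulN1r addr0 normrN.
- by rewrite oppr_ge0 ltW.
Qed.

(** The rate [K + 2], in place of the sharp [K], also absorbs the forcing: with [A > eta] and an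
    exponential at least 1, the surplus in the derivative of [A * expR ((K + 2) * t)] strictly
    exceeds [eta]. *)
Lemma gronwall f (f' : R -> V) (K eta T : R) : 0 <= K -> 0 <= eta ->
  (forall t, t \in `[0, T] -> is_derive t (1 : R) f (f' t)) ->
  (forall t, t \in `[0, T] -> `|f' t| <= K * `|f t| + eta) ->
  forall t, t \in `[0, T] -> `|f t| <= (`|f 0| + eta) * expR ((K + 2) * t).
Proof.
move=> K0 eta0 fd fK t tT; apply/ler_addgt0Pr => e e0.
pose e' := e / expR ((K + 2) * t); have e'0 : 0 < e' by rewrite divr_gt0// expR_gt0.
have -> : (`|f 0| + eta) * expR ((K + 2) * t) + e =
    (`|f 0| + eta + e') * expR ((K + 2) * t).
  by rewrite [in RHS]mulrDl /e' divfK// gt_eqF// expR_gt0.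
have A0 : 0 <= `|f 0| by [].
pose A := `|f 0| + eta + e'.
apply: (@fencing _ _ f f' (fun t => A * expR ((K + 2) * t))
  (fun t => A * (K + 2) * expR ((K + 2) * t)) T fd _ _ _ t tT).
- by move=> s _; exact: is_derive_exp_scale.
- by rewrite mulr0 expR0 mulr1 /A; lra.
- move=> s sT fs; apply: le_lt_trans (fK s sT) _; rewrite fs.
  have : 1 <= expR ((K + 2) * s).
    rewrite (le_trans _ (expR_ge1Dx _))// lerDl mulr_ge0 ?addr_ge0//.
    by move/itvP: sT => ->.
  move: (expR _) => E E1.
  have : A * 1 <= A * E by rewrite ler_wpM2l// /A; lra.
  rewrite /A in A0 *.
  lra.
Qed.

End estimates.

(** * Primitives and completeness *)

(** Taken as a property of [V] so that Picard iteration needs no vector-valued integral: it is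
    proved on the real line and passes to row vectors and pairs componentwise. *)
Definition has_primitives (R : realType) (V : normedModType R) :=
  forall f : R -> V, continuous f ->
  exists F : R -> V, forall t, is_derive t (1 : R) F (f t).

(** Completeness in the form the Picard iterates require, with the tail of the geometric series as
    explicit rate. The rate survives the passage to components because the norms are maxima. *)
Definition geometrically_complete (R : realType) (V : normedModType R) :=
  forall (u : nat -> V) (C : R), (forall k, `|u k.+1 - u k| <= C / 2 ^+ k) ->
  exists l, forall k, `|u k - l| <= C * 2 / 2 ^+ k.

Section real_line.
Variable R : realType.
Notation mu := (@lebesgue_measure R).

Lemma continuous_integrable_itv (f : R -> R) (a b : R) : continuous f ->
  mu.-integrable `[a, b] (EFin \o f).
Proof.
move=> fc; apply: continuous_compact_integrable; first exact: segment_compact.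
exact: continuous_subspaceT.
Qed.

Lemma Rintegral_base_change (f : R -> R) (a b t : R) : continuous f ->
  a <= b -> b <= 0 -> b <= t ->
  \int[mu]_(s in `[a, t]) f s - \int[mu]_(s in `[a, 0]) f s =
  \int[mu]_(s in `[b, t]) f s - \int[mu]_(s in `[b, 0]) f s.
Proof.
move=> fc ab b0 bt.
have split c : b <= c -> \int[mu]_(s in `[a, c]) f s =
    \int[mu]_(s in `[a, b]) f s + \int[mu]_(s in `[b, c]) f s.
  move=> bc; apply/eqP; rewrite addrC -subr_eq; apply/eqP.
  rewrite Rintegral_itvB ?bnd_simp//; last exact: continuous_integrable_itv.
  rewrite Rintegral_itv_obnd_cbnd//.
  apply: (@integrableS _ _ _ mu `[b, c]) => //; first exact: subset_itv_oc_cc.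
  exact: continuous_integrable_itv.
have cancel (x y z : R) : (x + y) - (x + z) = y - z by ring.
by rewrite (split t bt) (split 0 b0) cancel.
Qed.

Lemma has_primitives_real : @has_primitives R R.
Proof.
move=> f fc.
pose G (a t : R) : R := \int[mu]_(s in `[a, t]) f s - \int[mu]_(s in `[a, 0]) f s.
(* An integral over [[a, t]] is useful only for [a] to the left of [t], so the base moves with [t].
   Subtracting the integral up to 0 removes the dependence on the base; near a given [t] the fixed
   base [- (|t| + 2)] serves all points at once. *)
exists (fun t => G (- (`|t| + 1)) t) => t.
pose a := - (`|t| + 2).
have Gd : is_derive t (1 : R) (G a) (f t).
  have at' : a < t by rewrite /a; have := ler_norm (- t); rewrite normrN; lra.
  have [d e] := continuous_FTC1_closed (ltr_pwDr ltr01 (lexx t))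
    (continuous_integrable_itv a (t + 1) fc) at' (fc t).
  have dd : is_derive t (1 : R) (fun x => \int[mu]_(s in `[a, x]) f s) (f t).
    by split=> //; rewrite -derive1E e.
  have := is_deriveB dd (is_derive_cst (\int[mu]_(s in `[a, 0]) f s) t 1).
  by move=> H; apply: (is_derive_eq H); rewrite subr0.
apply/is_derive1P => e e0; have [d d0 dP] := (is_derive1P _ _ _).1 Gd e e0.
have GE s : `|s - t| < 1 -> G (- (`|s| + 1)) s = G a s.
  move=> st; have := ler_normD (s - t) t; rewrite subrK => sn.
  have := ler_norm (- s); rewrite normrN => ns; have := normr_ge0 s => s0.
  by symmetry; apply: Rintegral_base_change => //; rewrite /a; lra.
exists (Num.min d 1) => [|h]; first by rewrite lt_min d0 /=.
rewrite lt_min => /andP[hd h1]; rewrite !GE ?subrr ?normr0//; first exact: dP.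
by rewrite addrAC subrr add0r.
Qed.

Lemma geometrically_complete_real : @geometrically_complete R R.
Proof.
move=> u C uC.
have C0 : 0 <= C by have := le_trans (normr_ge0 _) (uC 0); rewrite divr1.
(* The radii satisfy [d k = C / 2 ^+ k + d k.+1], so the intervals of radius [d k] around [u k] are
   nested; the limit is the supremum of their left ends. *)
pose d k : R := C * 2 / 2 ^+ k.
have dS k : d k = C / 2 ^+ k + d k.+1 by rewrite /d exprS; field; rewrite expf_neq0.
have d0 k : 0 <= d k by rewrite divr_ge0 ?mulr_ge0// exprn_ge0.
have step k : - (C / 2 ^+ k) <= u k.+1 - u k <= C / 2 ^+ k.
  by rewrite -ler_norml.
have lo : {homo (fun k => u k - d k) : m n / (m <= n)%N >-> m <= n}.
  apply: (homo_leq (r := fun x y : R => x <= y)) => // [x y z|k]; first exact: le_trans.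
  by have /andP[] := step k; rewrite (dS k); lra.
have hi : {homo (fun k => - (u k + d k)) : m n / (m <= n)%N >-> m <= n}.
  apply: (homo_leq (r := fun x y : R => x <= y)) => // [x y z|k]; first exact: le_trans.
  by have /andP[] := step k; rewrite (dS k); lra.
have lohi k m : u k - d k <= u m + d m.
  have := lo _ _ (leq_maxl k m); have := hi _ _ (leq_maxr k m).
  by have := d0 (maxn k m); lra.
pose S := [set u k - d k | k in setT].
have Sub m : ubound S (u m + d m) by move=> _ [k _ <-].
have supS : has_sup S.
  by split; [exists (u 0 - d 0); exists 0 | exists (u 0 + d 0)].
exists (sup S) => k; rewrite ler_norml.
have : sup S <= u k + d k by apply: ge_sup (Sub k); case: supS.
have : u k - d k <= sup S by apply: ub_le_sup; [case: supS | exists k].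
by rewrite -/(d k); lra.
Qed.

End real_line.

Section row_vectors.
Variables (R : realType) (n : nat).

Lemma ler_norm_coord (v : 'rV[R]_n) j : `|v 0 j| <= `|v|.
Proof. by rewrite [leRHS]mx_normrE (le_bigmax _ (fun i => `|v i.1 i.2|) (0, j)). Qed.

Lemma ler_rV_norm (v : 'rV[R]_n) (r : R) : 0 <= r ->
  (forall j, `|v 0 j| <= r) -> `|v| <= r.
Proof.
move=> r0 vr; rewrite [leLHS]mx_normrE; apply: bigmax_le => // -[i j] _ /=.
by rewrite [i]ord1.
Qed.

Lemma is_derive1_rV (f : R -> 'rV[R]_n) t (v : 'rV[R]_n) :
  (forall j, is_derive t (1 : R) (fun s => f s 0 j) (v 0 j)) -> is_derive t (1 : R) f v.
Proof.
move=> fv; have fd : derivable f t 1.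
  by apply/derivable_mxP => i j; rewrite [i]ord1; exact: ex_derive.
split=> //; rewrite derive_mx//; apply/rowP => j; rewrite mxE.
exact: derive_val.
Qed.

Lemma has_primitives_rV : has_primitives 'rV[R]_n.
Proof.
move=> f fc.
have prim j : {F : R -> R | forall t, is_derive t (1 : R) F (f t 0 j)}.
  apply/cid/has_primitives_real => t.
  apply: (@continuous_comp _ _ _ f (fun v : 'rV[R]_n => v 0 j)); first exact: fc.
  exact: coord_continuous.
exists (fun t => \row_j sval (prim j) t) => t; apply: is_derive1_rV => j.
rewrite (_ : (fun s => _) = sval (prim j)); first exact: (svalP (prim j)).
by apply/funext => s; rewrite mxE.
Qed.

Lemma geometrically_complete_rV : geometrically_complete 'rV[R]_n.
Proof.
move=> u C uC.
have C0 : 0 <= C by have := le_trans (normr_ge0 _) (uC 0); rewrite divr1.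
have lim j : {l : R | forall k, `|u k 0 j - l| <= C * 2 / 2 ^+ k}.
  apply/cid/geometrically_complete_real => k.
  by apply: le_trans (uC k); apply: le_trans (ler_norm_coord _ j); rewrite !mxE.
exists (\row_j sval (lim j)) => k; apply: ler_rV_norm => [|j].
  by rewrite divr_ge0 ?mulr_ge0// exprn_ge0.
by rewrite !mxE; exact: (svalP (lim j)).
Qed.

End row_vectors.

Section products.
Variables (R : realType) (V W : normedModType R).

Lemma ler_pair_norm (z : V * W) (r : R) : (`|z| <= r) = (`|z.1| <= r) && (`|z.2| <= r).
Proof. by rewrite prod_normE ge_max. Qed.

Lemma is_derive1_pair (f : R -> V) (g : R -> W) t v w :
  is_derive t (1 : R) f v -> is_derive t (1 : R) g w ->
  is_derive t (1 : R) (fun s => (f s, g s)) (v, w).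
Proof.
move=> /is_derive1P fv /is_derive1P gw; apply/is_derive1P => e e0.
have [d1 d10 d1P] := fv e e0; have [d2 d20 d2P] := gw e e0.
exists (Num.min d1 d2) => [|h]; first by rewrite lt_min d10.
by rewrite lt_min => /andP[/d1P h1 /d2P h2]; rewrite ler_pair_norm /= h1 h2.
Qed.

Lemma is_derive1_fst (f : R -> V * W) t v : is_derive t (1 : R) f v ->
  is_derive t (1 : R) (fun s => (f s).1) v.1.
Proof.
move=> /(@is_derive1_linear _ _ _ (fun z : V * W => z.1) 1); apply => // z.
by rewrite mul1r; have := lexx `|z|; rewrite ler_pair_norm => /andP[].
Qed.

Lemma has_primitives_pair : has_primitives V -> has_primitives W ->
  has_primitives (V * W)%type.
Proof.
move=> pV pW f fc.
have [t|F FP] := pV (fun t => (f t).1).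
  by apply: (@continuous_comp _ _ _ f fst); [exact: fc | exact: cvg_fst].
have [t|G GP] := pW (fun t => (f t).2).
  by apply: (@continuous_comp _ _ _ f snd); [exact: fc | exact: cvg_snd].
exists (fun t => (F t, G t)) => t; rewrite [f t]surjective_pairing.
exact: is_derive1_pair.
Qed.

Lemma geometrically_complete_pair : geometrically_complete V ->
  geometrically_complete W -> geometrically_complete (V * W)%type.
Proof.
move=> cV cW u C uC.
have [k|l lP] := cV (fun k => (u k).1) C.
  by have := uC k; rewrite ler_pair_norm => /andP[].
have [k|m mP] := cW (fun k => (u k).2) C.
  by have := uC k; rewrite ler_pair_norm => /andP[].
by exists (l, m) => k; rewrite ler_pair_norm lP mP.
Qed.

End products.

(** * Picard iteration *)

Lemma exp2_small (R : realType) (D e : R) : 0 < e -> exists k : nat, D / 2 ^+ k < e.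
Proof.
move=> e0; exists (Num.bound `|D / e|).
rewrite ltr_pdivrMr ?exprn_gt0// mulrC -ltr_pdivrMr//.
apply: le_lt_trans (ler_norm _) _; apply: lt_trans (archi_boundP (normr_ge0 _)) _.
by rewrite -natrX ltr_nat ltn_expl.
Qed.

Lemma dist_eq0 (R : realType) (V : normedModType R) (x y : V) (D : R) :
  (forall k : nat, `|x - y| <= D / 2 ^+ k) -> x = y.
Proof.
move=> h; apply/eqP; rewrite -subr_eq0 -normr_le0 leNgt; apply/negP => /(exp2_small D)[k].
by rewrite ltNge h.
Qed.

Section picard.
Variables (R : realType) (V : normedModType R).
Hypotheses (pV : has_primitives V) (cV : geometrically_complete V).

(* The weight [expR (2 * L * `|t|)] makes each Picard step halve distances on
   the whole line at once. *)
Lemma picard_lindelof (F : R -> V -> V) (L B : R) (x0 : V) : 0 < L ->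
  (forall u : R -> V, continuous u -> continuous (fun t => F t (u t))) ->
  (forall t x y, `|F t x - F t y| <= L * `|x - y|) ->
  (forall t, `|F t x0| <= B) ->
  exists u : R -> V, u 0 = x0 /\ forall t, is_derive t (1 : R) u (F t (u t)).
Proof.
move=> L0 Fc FL FB.
(* Stated for every [u], with a dummy [w] when [u] is discontinuous, so that [choice] yields a total
   Picard map. *)
have step (u : R -> V) : exists w : R -> V, continuous u ->
    w 0 = x0 /\ forall t, is_derive t (1 : R) w (F t (u t)).
  have [uc|nuc] := pselect (continuous u); last by exists u => uc.
  have [w wd] := pV (Fc _ uc); exists (fun t => w t + (x0 - w 0)) => _.
  split=> [|t]; first by rewrite addrC subrK.
  have := is_deriveD (wd t) (is_derive_cst (x0 - w 0) t 1).
  by move=> H; apply: (is_derive_eq H); rewrite addr0.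
have [Phi PhiP] := choice step.
have dcont (w dw : R -> V) : (forall t, is_derive t (1 : R) w (dw t)) -> continuous w.
  by move=> wd t; exact: is_derive1_continuous (wd t).
pose us k := iter k Phi (cst x0).
have usc k : continuous (us k).
  elim: k => [|k IH]; first by move=> t; exact: cvg_cst.
  by have [_ /dcont] := PhiP _ IH.
have us0 k : us k 0 = x0 by case: k => // k; have [] := PhiP _ (usc k).
have usd k t : is_derive t (1 : R) (us k.+1) (F t (us k t)).
  by have [_] := PhiP _ (usc k).
pose M := 2 * L; have M0 : 0 < M by rewrite mulr_gt0.
have B0 : 0 <= B by exact: le_trans (FB 0).
(* [C * M = B] bounds the velocity of the first iterate, so [C] measures the first Picard step. *)
pose C := B / M; have C0 : 0 <= C by rewrite divr_ge0// ltW.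
have e1 (t : R) : 1 <= expR (M * `|t|).
  by rewrite (le_trans _ (expR_ge1Dx _))// lerDl mulr_ge0// ltW.
have contr (f g : R -> V) (f' g' : R -> V) (D : R) : 0 <= D ->
    (forall t, is_derive t (1 : R) f' (F t (f t))) ->
    (forall t, is_derive t (1 : R) g' (F t (g t))) -> f' 0 = g' 0 ->
    (forall t, `|f t - g t| <= D * expR (M * `|t|)) ->
    forall t, `|f' t - g' t| <= D / 2 * expR (M * `|t|).
  move=> D0 fd gd fg0 fg t.
  have -> : f' t - g' t = (f' - g') t - (f' - g') 0.
    by rewrite -[(f' - g') 0]/(f' 0 - g' 0) fg0 subrr subr0.
  apply: le_trans (_ : _ <= D / 2 * expR (M * `|t|) - D / 2) _; last first.
    by rewrite gerBl divr_ge0.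
  apply: (mean_value_exp M0 (fun t => is_deriveB (fd t) (gd t))) => s.
  apply: le_trans (FL _ _ _) _.
  have -> : D / 2 * M = L * D by rewrite /M; field.
  by rewrite -mulrA ler_pM2l.
have usE k t : `|us k.+1 t - us k t| <= C / 2 ^+ k * expR (M * `|t|).
  elim: k t => [|k IH] t.
    rewrite -[us 0%N t]/x0 -(us0 1%N) divr1.
    apply: le_trans (_ : _ <= C * expR (M * `|t|) - C) _; last by rewrite gerBl.
    apply: (mean_value_exp M0 (usd 0)) => s.
    rewrite /C divfK ?gt_eqF//; apply: le_trans (FB s) _.
    by rewrite ler_peMr.
  have -> : C / 2 ^+ k.+1 = C / 2 ^+ k / 2 by rewrite exprSr invfM mulrA mulrAC.
  apply: contr (usd k.+1) (usd k) _ IH t; last by rewrite !us0.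
  by rewrite divr_ge0 ?exprn_ge0//.
have lim t : {l | forall k, `|us k t - l| <= C * expR (M * `|t|) * 2 / 2 ^+ k}.
  by apply/cid/cV => k; apply: le_trans (usE k t) _; rewrite mulrAC.
pose u t := sval (lim t).
have uP t k : `|us k t - u t| <= C * expR (M * `|t|) * 2 / 2 ^+ k.
  exact: (svalP (lim t)).
have uc : continuous u.
  (* [D] bounds the weight within distance 1 of [t]: convergence is locally uniform, and the usual
     [e / 3] argument applies. *)
  move=> t; apply/cvgrPdist_lt => e e0; pose D := C * expR (M * (`|t| + 1)) * 2.
  have e3 : 0 < e / 3 by rewrite divr_gt0.
  have [k kD] := exp2_small D e3.
  have near_u s : `|t - s| < 1 -> `|us k s - u s| < e / 3.
    move=> ts; apply: le_lt_trans (uP s k) _; apply: le_lt_trans _ kD.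
    rewrite /D ler_pM2r ?invr_gt0 ?exprn_gt0// ler_pM2r// ler_wpM2l//.
    rewrite ler_expR ler_pM2l//.
    by have := ler_normB t (t - s); rewrite opprB addrC subrK; lra.
  have /cvgrPdist_lt/(_ _ e3)[d /= d0 dP] := usc k t.
  exists (Num.min d 1) => /= [|s]; first by rewrite lt_min d0 /=.
  rewrite /ball_ /= lt_min => /andP[/dP usts ts].
  have us_s := near_u s ts; have us_t := near_u t.
  rewrite subrr normr0 ltr01 in us_t; have {}us_t := us_t isT.
  have -> : u t - u s = (us k s - u s) - (us k t - u t) + (us k t - us k s).
    by rewrite opprB -addrA subrKA addrC subrKA.
  apply: le_lt_trans (ler_normD _ _) _.
  by have := ler_normB (us k s - u s) (us k t - u t); lra.
have [w0 wd] := PhiP _ uc.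
(* The iterate [us k.+1] is geometrically close both to [u] and, by [contr], to [Phi u]. *)
suff uw : Phi u = u by exists u; rewrite -{1}uw; split => // t; rewrite -{1}uw.
apply/funext => t; symmetry.
apply: (@dist_eq0 _ _ _ _ (2 * (C * expR (M * `|t|)))) => k.
have := uP t k.+1.
have := contr _ _ _ _ (C * 2 / 2 ^+ k) _ (usd k) wd _ _ t.
rewrite w0 us0 => H1 H2.
have {}H1 : `|us k.+1 t - Phi u t| <= C * 2 / 2 ^+ k / 2 * expR (M * `|t|).
  apply: H1 => // [|s].
    by apply: divr_ge0; [exact: mulr_ge0 | exact: exprn_ge0].
  apply: le_trans (uP s k) _; rewrite le_eqVlt; apply/orP; left; apply/eqP.
  by field; rewrite expf_neq0.
have -> : u t - Phi u t = us k.+1 t - Phi u t - (us k.+1 t - u t).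
  by rewrite opprB [RHS]addrC subrKA.
apply: le_trans (ler_normB _ _) _; apply: le_trans (lerD H1 H2) _.
rewrite le_eqVlt; apply/orP; left; apply/eqP; rewrite exprS; field.
by rewrite expf_neq0.
Qed.

End picard.

(** * Differentiability of the flow *)

(** Radial projection onto the ball. In a general norm it need not be 1-Lipschitz; the factor 2
    comes from adding the change of the scalar [k] to the change of the vector, using that
    [k z * |z|], the minimum of [r] and [|z|], grows with [|z|]. *)
Lemma ball_retraction (R : realType) (V : normedModType R) (r : R) : 0 < r ->
  exists rho : V -> V, [/\ forall z, `|rho z| <= r,
    forall z, `|z| <= r -> rho z = z &
    forall x y, `|rho x - rho y| <= 2 * `|x - y|].
Proof.
move=> r0; pose k (z : V) : R := r / Num.max r `|z|.
have M0 (z : V) : 0 < Num.max r `|z| by rewrite lt_max r0.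
have k0 z : 0 <= k z by rewrite divr_ge0 ?ltW.
have kz (z : V) : k z * `|z| <= r.
  by rewrite /k mulrAC ler_pdivrMr// ler_pM2l// le_max lexx orbT.
have k1 (z : V) : k z <= 1 by rewrite ler_pdivrMr// mul1r le_max lexx.
exists (fun z => k z *: z); split => [z|z zr|].
- by rewrite normrZ ger0_norm.
- by rewrite /k max_l// divff ?scale1r// gt_eqF.
have wlog_le (x y : V) : `|x| <= `|y| -> `|k x *: x - k y *: y| <= 2 * `|x - y|.
  move=> xy.
  have -> : k x *: x - k y *: y = (k x - k y) *: x + k y *: (x - y).
    by rewrite scalerBl scalerBr addrA subrK.
  have kxy : k y <= k x.
    by rewrite /k ler_pM2l// lef_pV2 ?posrE// ge_max !le_max lexx xy orbT.
  have kyx : `|k y *: (x - y)| <= `|x - y|.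
    by rewrite normrZ ger0_norm// ler_piMl.
  apply: le_trans (ler_normD _ _) _.
  suff : `|(k x - k y) *: x| <= `|x - y| by lra.
  rewrite normrZ ger0_norm ?subr_ge0// mulrBl.
  have H : k x * `|x| <= k y * `|y|.
    rewrite /k ![_ / _ * _]mulrAC -!mulrA ler_pM2l//.
    have [yr|yr] := leP `|y| r.
      rewrite max_l ?ler_wpM2r ?invr_ge0//; last exact: le_trans yr.
      exact: ltW.
    rewrite divff ?gt_eqF ?(lt_trans r0)//.
    by rewrite ler_pdivrMr// mul1r le_max lexx orbT.
  have := lerB_dist y x; rewrite distrC => H2.
  have : k y * (`|y| - `|x|) <= `|y| - `|x| by rewrite ler_piMl// subr_ge0.
  lra.
move=> x y; have [xy|/ltW xy] := leP `|x| `|y|; first exact: wlog_le.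
by rewrite distrC [`|x - y|]distrC; exact: wlog_le.
Qed.

Lemma curve_bounded (R : realType) (V : normedModType R) (c dc : R -> V) (T : R) :
  0 <= T -> (forall t : R, t \in `[0, T] -> is_derive t (1 : R) c (dc t)) ->
  exists2 r, 0 < r & forall t, t \in `[0, T] -> `|c t| <= r.
Proof.
move=> T0 cd; have [|t tT tmax] := @EVT_max _ (fun t => `|c t|) 0 T T0.
  apply: continuous_in_subspaceT => t; rewrite inE/= => tT.
  by apply: cvg_norm; exact: is_derive1_continuous (cd t tT).
exists (`|c t| + 1) => [|s sT]; first by rewrite ltr_wpDl.
by rewrite (le_trans (tmax s sT))// lerDl.
Qed.

Lemma is_derive_scalel (R : realType) (V : normedModType R) (v : V) (s : R) :
  is_derive s (1 : R) (fun s => s *: v) v.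
Proof.
apply/is_derive1P => e e0; exists 1 => // h _.
by rewrite scalerDl addrAC addrK subrr normr0 mulr_ge0// ltW.
Qed.

Lemma mean_value_unit (R : realType) (V : normedModType R) (f f' : R -> V) (D : R) :
  (forall s : R, s \in `[0, 1] -> is_derive s (1 : R) f (f' s)) ->
  (forall s : R, s \in `[0, 1] -> `|f' s| <= D) -> `|f 1 - f 0| <= D.
Proof.
move=> fd fD; have i1 : (1 : R) \in `[0, 1] by rewrite in_itv/= ler01 lexx.
have := mean_value_le fd (fun s _ => is_derive_scalel (D : R^o) s) fD i1.
by rewrite scale1r scale0r subr0.
Qed.

Lemma is_derive_line (R : realType) (V W : normedModType R) (f : V -> W)
    (z u : V) (s : R) (v : W) : is_derive (z + s *: u) u f v ->
  is_derive s (1 : R) (fun s => f (z + s *: u)) v.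
Proof.
have quotE : (fun h : R => h^-1 *:
      (((fun s => f (z + s *: u)) \o shift s) (h *: 1) - f (z + s *: u)))
    = (fun h : R => h^-1 *: ((f \o shift (z + s *: u)) (h *: u) - f (z + s *: u))).
  apply/funext => h; congr (_ *: (f _ - _)); rewrite /shift/=.
  by rewrite [h *: 1]mulr1 scalerDl addrCA.
by move=> [fd fv]; split; [rewrite /derivable quotE | rewrite /derive quotE].
Qed.

Lemma cvg_dist_le (R : realType) (V : normedModType R) (f : R -> V) (g : R -> R) (t : R) :
  g @ t --> (0 : R) -> (forall s, `|f t - f s| <= g s) -> {for t, continuous f}.
Proof.
move=> g0 fg; apply/cvgrPdist_lt => e e0.
move/cvgrPdist_lt/(_ e e0): g0; apply: filterS => s.
by rewrite sub0r normrN; apply: le_lt_trans; apply: le_trans (fg s) (ler_norm _).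
Qed.

Section flow.
Variables (R : realType) (V : normedModType R) (X : V -> V).
Hypothesis X_diff : forall z, differentiable X z.
Hypothesis dX_bounded : forall r, exists K, forall z u,
  `|z| <= r -> `|'d X z u| <= K * `|u|.
Hypothesis dX_lipschitz : forall r, exists K, forall z z' u,
  `|z| <= r -> `|z'| <= r -> `|'d X z u - 'd X z' u| <= K * `|z - z'| * `|u|.

Lemma is_derive_segment (z u : V) (s : R) :
  is_derive s (1 : R) (fun s => X (z + s *: u)) ('d X (z + s *: u) u).
Proof.
apply: is_derive_line; split; first exact: diff_derivable.
exact: deriveE.
Qed.

Lemma segment_bounded (z y : V) (r s : R) : `|z| <= r -> `|y| <= r ->
  s \in `[0, 1] -> `|z + s *: (y - z)| <= r.
Proof.
move=> zr yr /[!in_itv]/= /andP[s0 s1].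
have -> : z + s *: (y - z) = (1 - s) *: z + s *: y.
  by rewrite scalerBr scalerBl scale1r addrA [RHS]addrAC.
apply: le_trans (ler_normD _ _) _; rewrite !normrZ !ger0_norm ?subr_ge0//.
have : (1 - s) * `|z| <= (1 - s) * r by rewrite ler_wpM2l// subr_ge0.
have : s * `|y| <= s * r by rewrite ler_wpM2l.
lra.
Qed.

Lemma vector_field_lipschitz r : exists K, [/\ 0 <= K,
  (forall z u, `|z| <= r -> `|'d X z u| <= K * `|u|),
  (forall z z' u, `|z| <= r -> `|z'| <= r ->
     `|'d X z u - 'd X z' u| <= K * `|z - z'| * `|u|),
  (forall x y, `|x| <= r -> `|y| <= r -> `|X x - X y| <= K * `|x - y|) &
  (forall x y, `|x| <= r -> `|y| <= r ->
     `|X x - X y - 'd X y (x - y)| <= K * `|x - y| ^+ 2)].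
Proof.
have [K1 K1P] := dX_bounded r; have [K2 K2P] := dX_lipschitz r.
pose K := `|K1| + `|K2|; have K0 : 0 <= K by rewrite addr_ge0.
have K1K : K1 <= K by rewrite (le_trans (ler_norm _))// lerDl.
have K2K : K2 <= K by rewrite (le_trans (ler_norm _))// lerDr.
have {}K1P z u : `|z| <= r -> `|'d X z u| <= K * `|u|.
  by move=> /K1P H; rewrite (le_trans (H _))// ler_wpM2r.
have {}K2P z z' u : `|z| <= r -> `|z'| <= r ->
    `|'d X z u - 'd X z' u| <= K * `|z - z'| * `|u|.
  by move=> zr /(K2P _ _ u zr) H; rewrite (le_trans H)// !ler_wpM2r.
have i1 : (1 : R) \in `[0, 1] by rewrite in_itv/= ler01 lexx.
exists K; split => // x y xr yr.
- have := mean_value_unit (fun s _ => is_derive_segment y (x - y) s).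
  rewrite scale1r scale0r addr0 subrKC; apply => s s01.
  by apply: K1P; exact: segment_bounded.
(* Subtracting [s *: 'd X y (x - y)] leaves a curve whose velocity is a difference of two
   differentials, hence of size [|x - y| ^+ 2]. *)
- have := mean_value_unit (fun s _ => is_deriveB (is_derive_segment y (x - y) s)
    (is_derive_scalel ('d X y (x - y)) s)).
  rewrite -![((fun s => X (y + s *: (x - y))) - _) _]
    /(X (y + _ *: (x - y)) - _ *: 'd X y (x - y)).
  rewrite !scale1r !scale0r addr0 subrKC subr0 addrAC; apply => s s01.
  apply: le_trans (K2P _ _ _ (segment_bounded yr xr s01) yr) _.
  rewrite addrAC subrr add0r normrZ expr2 [leRHS]mulrA ler_wpM2r// ler_wpM2l//.
  by move: s01; rewrite in_itv/= => /andP[s0 s1]; rewrite ger0_norm// ler_piMl.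
Qed.

(** Gronwall with zero initial gap and zero forcing, on a ball containing both curves. It makes the
    choice in [flow] unambiguous. *)
Lemma flows_to_unique (t : R) (z w w' : V) : 0 <= t ->
  flows_to X t z w -> flows_to X t z w' -> w = w'.
Proof.
move=> t0 [a [b [c [a0b atb cX c0 ct]]]] [a' [b' [c' [a0b' atb' cX' c0' ct']]]].
have cd s : s \in `[0, t] -> is_derive s (1 : R) c (X (c s)).
  move=> /[!in_itv]/= /andP[s0 st]; apply: cX.
  move: a0b atb; rewrite !in_itv/= => /andP[a0 _] /andP[_ tb].
  by rewrite (lt_le_trans a0)// (le_lt_trans st).
have cd' s : s \in `[0, t] -> is_derive s (1 : R) c' (X (c' s)).
  move=> /[!in_itv]/= /andP[s0 st]; apply: cX'.
  move: a0b' atb'; rewrite !in_itv/= => /andP[a0 _] /andP[_ tb].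
  by rewrite (lt_le_trans a0)// (le_lt_trans st).
have [r1 r10 r1P] := curve_bounded t0 cd; have [r2 r20 r2P] := curve_bounded t0 cd'.
have [K [K0 _ _ KP _]] := vector_field_lipschitz (Num.max r1 r2).
have tt : t \in `[0, t] by rewrite in_itv/= t0 lexx.
have := @gronwall _ _ (c - c') (fun s => X (c s) - X (c' s)) K 0 t K0 (lexx 0)
  (fun s st => is_deriveB (cd s st) (cd' s st)) _ t tt.
rewrite -[(c - c') 0]/(c 0 - c' 0) -[(c - c') t]/(c t - c' t) c0 c0' ct ct'.
rewrite subrr normr0 addr0 mul0r normr_le0 subr_eq0 => H; apply/eqP/H => s st.
by rewrite addr0; apply: KP; rewrite le_max ?r1P ?r2P ?orbT.
Qed.

Lemma flowE (t : R) (z w : V) : 0 <= t -> flows_to X t z w -> flow X t z = w.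
Proof.
by move=> t0 zw; apply: (flows_to_unique t0 _ zw); apply: xgetPex; exists w.
Qed.

Hypotheses (pV : has_primitives V) (cV : geometrically_complete V).

Lemma variational_solution (c : R -> V) (h : V) :
  (forall t : R, t \in `[0, 1] -> is_derive t (1 : R) c (X (c t))) ->
  exists2 w : R -> V, w 0 = h &
    forall t : R, t \in `[0, 1] -> is_derive t (1 : R) w ('d X (c t) (w t)).
Proof.
move=> cd; have [r r0 rP] := curve_bounded ler01 cd.
have [K [K0 dXK dXL _ _]] := vector_field_lipschitz r.
(* The nearest point of [[0, 1]]: it extends the coefficients of the variational equation to the
   whole line, as [picard_lindelof] requires. *)
pose clamp (t : R) : R := (`|t| - `|t - 1| + 1) / 2.
have clamp01 t : clamp t \in `[0, 1].
  rewrite in_itv/= /clamp; have := ler_normB t 1; have := ler_normD (t - 1) 1.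
  by rewrite subrK normr1; lra.
have clampE t : t \in `[0, 1] -> clamp t = t.
  rewrite in_itv/= /clamp => /andP[t0 t1].
  by rewrite distrC !ger0_norm ?subr_ge0//; field.
have clampc : continuous clamp.
  move=> t; apply: cvgMl; apply: cvgD; last exact: cvg_cst.
  by apply: cvgB; apply: cvg_norm => //; apply: cvgB => //; exact: cvg_cst.
have cc : continuous (c \o clamp).
  move=> t; apply: continuous_comp; first exact: clampc.
  exact: is_derive1_continuous (cd _ (clamp01 t)).
pose F t x := 'd X (c (clamp t)) x.
have [|u uc t|t x y|t|u [u0 ud]] := @picard_lindelof _ _ pV cV F (K + 1) (K * `|h|) h.
- by rewrite ltr_wpDl.
- pose g s := K * `|u t - u s| + K * `|c (clamp t) - c (clamp s)| * `|u t|.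
  apply: (@cvg_dist_le _ _ _ g) => [|s].
    rewrite (_ : 0 = g t); last by rewrite /g !subrr normr0 !mulr0 mul0r addr0.
    apply: cvgD; [apply: cvgMr | apply: cvgMl; apply: cvgMr].
      by apply: cvg_norm; apply: cvgB; [exact: cvg_cst | exact: uc].
    by apply: cvg_norm; apply: cvgB; [exact: cvg_cst | exact: cc].
  have -> : F t (u t) - F s (u s) = 'd X (c (clamp s)) (u t - u s) +
      ('d X (c (clamp t)) (u t) - 'd X (c (clamp s)) (u t)).
    by rewrite linearB [RHS]addrC subrKA.
  apply: le_trans (ler_normD _ _) _; apply: lerD; first exact: dXK (rP _ (clamp01 s)).
  exact: dXL (rP _ (clamp01 t)) (rP _ (clamp01 s)).
- rewrite /F -linearB; apply: le_trans (dXK _ _ (rP _ (clamp01 t))) _.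
  by rewrite ler_wpM2r// lerDl.
- exact: dXK (rP _ (clamp01 t)).
by exists u => // t t01; have := ud t; rewrite /F clampE.
Qed.

(** [K] and [d] are fixed before [h], and [w] is supplied by the user, who may thus choose solutions
    that are visibly linear in [h]. *)
Lemma flow_linearization (c : R -> V) :
  (forall t : R, t \in `[0, 1] -> is_derive t (1 : R) c (X (c t))) ->
  exists K, exists2 d, 0 < d & forall (h : V) (w : R -> V), `|h| < d -> w 0 = h ->
  (forall t : R, t \in `[0, 1] -> is_derive t (1 : R) w ('d X (c t) (w t))) ->
  exists2 z, flows_to X 1 (c 0 + h) z & `|z - c 1 - w 1| <= K * `|h| ^+ 2.
Proof.
move=> cd; have [r r0 rP] := curve_bounded ler01 cd.
have r10 : 0 < r + 1 by rewrite addr_gt0.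
have [K [K0 dXK _ XL Xq]] := vector_field_lipschitz (r + 1).
have [rho [rho_r rhoE rhoL]] := ball_retraction V r10.
have i1 : (1 : R) \in `[0, 1] by rewrite in_itv/= ler01 lexx.
have i0 : (0 : R) \in `[0, 1] by rewrite in_itv/= ler01 lexx.
have cr t : t \in `[0, 1] -> `|c t| <= r + 1 by move/rP => ?; lra.
have XrhoL x y : `|X (rho x) - X (rho y)| <= 2 * K * `|x - y|.
  apply: le_trans (XL _ _ (rho_r _) (rho_r _)) _.
  by have := ler_wpM2l K0 (rhoL x y); lra.
pose L := 2 * K; have L0 : 0 <= L by rewrite mulr_ge0.
pose E := expR (L + 2); have E0 : 0 < E by exact: expR_gt0.
exists (K * E ^+ 2 * expR (K + 2)), E^-1 => [|h w hd w0 wd]; first by rewrite invr_gt0.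
have [|u uc t|t x y|t|u [u0 ud]] := @picard_lindelof _ _ pV cV (fun _ x => X (rho x))
  (L + 1) `|X (rho (c 0 + h))| (c 0 + h).
- by rewrite ltr_wpDl.
- apply: (@cvg_dist_le _ _ _ (fun s => L * `|u t - u s|)) => [|s]; last exact: XrhoL.
  rewrite (_ : 0 = L * `|u t - u t|); last by rewrite subrr normr0 mulr0.
  by apply: cvgMr; apply: cvg_norm; apply: cvgB; [exact: cvg_cst | exact: uc].
- by apply: le_trans (XrhoL _ _) _; rewrite ler_wpM2r// lerDl.
- by [].
have uc : continuous u by move=> t; exact: is_derive1_continuous (ud t).
have v_le t : t \in `[0, 1] -> `|u t - c t| <= `|h| * E.
  move=> t01; have := @gronwall _ _ (u - c) (fun s => X (rho (u s)) - X (c s)) L 0 1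
    L0 (lexx 0) (fun s s01 => is_deriveB (ud s) (cd s s01)) _ t t01.
  rewrite -[(u - c) 0]/(u 0 - c 0) u0 addrAC subrr add0r addr0 => H.
  apply: le_trans (H _) _ => [s s01|].
    by rewrite addr0 -{1}(rhoE (c s) (cr s s01)).
  rewrite ler_wpM2l// ler_expR ler_piMr ?addr_ge0//.
  by move: t01; rewrite in_itv => /andP[].
have hE : `|h| * E < 1 by rewrite -ltr_pdivlMr// mul1r.
have u_lt t : t \in `[0, 1] -> `|u t| < r + 1.
  move=> t01; have := v_le t t01; have := rP t t01; have := ler_normD (u t - c t) (c t).
  by rewrite subrK; lra.
exists (u 1).
  (* [flows_to] wants an open time interval; the strict bound at times 0 and 1 extends slightly
     beyond them by continuity. *)
  have near_lt t : `|u t| < r + 1 ->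
      exists2 e, 0 < e & forall s, `|t - s| < e -> `|u s| <= r + 1.
    rewrite -subr_gt0; have /cvgrPdist_lt uct := uc t.
    move=> /uct[e /= e0 eP]; exists e => // s /eP us.
    by have := ler_normB (u t) (u t - u s); rewrite opprB addrC subrK; lra.
  have [e0 e00 e0P] := near_lt 0 (u_lt 0 i0).
  have [e1 e10 e1P] := near_lt 1 (u_lt 1 i1).
  have u_le t : t \in `]- e0, 1 + e1[ -> `|u t| <= r + 1.
    rewrite in_itv/= => /andP[t1 t2].
    have [t0|t0] := ltP t 0; first by apply: e0P; rewrite gtr0_norm; lra.
    have [t3|t3] := ltP 1 t; first by apply: e1P; rewrite ltr0_norm; lra.
    by apply/ltW/u_lt; rewrite in_itv/= t0 t3.
  exists (- e0), (1 + e1), u; split => //; rewrite ?in_itv/=; [lra|lra|].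
  by move=> t /u_le ut; rewrite -{1}(rhoE _ ut).
have := @gronwall _ _ (u - c - w) (fun s => X (rho (u s)) - X (c s) - 'd X (c s) (w s))
  K (K * E ^+ 2 * `|h| ^+ 2) 1 K0 _
  (fun s s01 => is_deriveB (is_deriveB (ud s) (cd s s01)) (wd s s01)) _ 1 i1.
rewrite -[(u - c - w) 0]/(u 0 - c 0 - w 0) -[(u - c - w) 1]/(u 1 - c 1 - w 1).
have -> : u 0 - c 0 - w 0 = 0 by rewrite u0 w0 addrAC addrK subrr.
rewrite normr0 add0r mulr1 => H.
rewrite mulrAC; apply: H => [|s s01].
  by apply: mulr_ge0; [apply: mulr_ge0 => // |]; exact: sqr_ge0.
rewrite (rhoE _ (ltW (u_lt s s01))) -[(u - c - w) s]/(u s - c s - w s).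
(* The error [u - c - w] starts at 0 and solves the variational equation up to the Taylor remainder
   of [X], of order [|u s - c s| ^+ 2]. *)
have -> : X (u s) - X (c s) - 'd X (c s) (w s) =
    'd X (c s) (u s - c s - w s) + (X (u s) - X (c s) - 'd X (c s) (u s - c s)).
  by rewrite (linearB _ (u s - c s)) [RHS]addrC subrKA.
apply: le_trans (ler_normD _ _) _; apply: lerD; first exact: dXK (cr s s01).
apply: le_trans (Xq _ _ (ltW (u_lt s s01)) (cr s s01)) _.
rewrite -mulrA -exprMn ler_wpM2l// [E * _]mulrC.
by rewrite ler_pXn2r// ?nnegrE ?mulr_ge0 ?v_le// ltW.
Qed.

End flow.

(** * Smooth vector fields on phase space *)

Section phase_space_coordinates.
Variables (R : realType) (n : nat).
Implicit Types (z u : phase_space R n) (i : 'I_(n + n)).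

Definition coordinate i z : R :=
  match fintype.split i with inl j => z.1 0 j | inr j => z.2 0 j end.

Definition coordinate_vector i : phase_space R n :=
  match fintype.split i with inl j => (delta_mx 0 j, 0) | inr j => (0, delta_mx 0 j) end.

Lemma coordinate_le z i : `|coordinate i z| <= `|z|.
Proof.
have := lexx `|z|; rewrite ler_pair_norm => /andP[z1 z2]; rewrite /coordinate.
by case: fintype.split => j; exact: le_trans (ler_norm_coord _ j) _.
Qed.

Lemma norm_le_coordinates z (r : R) : 0 <= r ->
  (forall i, `|coordinate i z| <= r) -> `|z| <= r.
Proof.
move=> r0 zr; rewrite ler_pair_norm; apply/andP; split; apply: ler_rV_norm => // j.
  by have := zr (lshift n j); rewrite /coordinate (unsplitK (inl j)).
by have := zr (rshift n j); rewrite /coordinate (unsplitK (inr j)).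
Qed.

Lemma coordinateB i z u : coordinate i (z - u) = coordinate i z - coordinate i u.
Proof. by rewrite /coordinate; case: fintype.split => j; rewrite !mxE. Qed.

Lemma coordinateZ i (k : R) z : coordinate i (k *: z) = k * coordinate i z.
Proof. by rewrite /coordinate; case: fintype.split => j; rewrite !mxE. Qed.

Lemma sum_coordinates z : z = \sum_i coordinate i z *: coordinate_vector i.
Proof.
have fstE (I : finType) (F : I -> phase_space R n) : (\sum_i F i).1 = \sum_i (F i).1.
  exact: (big_morph fst).
have sndE (I : finType) (F : I -> phase_space R n) : (\sum_i F i).2 = \sum_i (F i).2.
  exact: (big_morph snd).
have E1 j : fintype.split (lshift n j) = inl j := unsplitK (inl j).
have E2 j : fintype.split (rshift n j) = inr j := unsplitK (inr j).
rewrite big_split_ord /= /coordinate /coordinate_vector.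
under eq_bigr do rewrite E1; under [X in _ = _ + X]eq_bigr do rewrite E2.
rewrite [LHS]surjective_pairing; congr (_, _).
  by rewrite /= !fstE /= -row_sum_delta big1 ?addr0// => j _; rewrite scaler0.
by rewrite /= !sndE /= -row_sum_delta big1 ?add0r// => j _; rewrite scaler0.
Qed.

Lemma phase_space_ball_compact (r : R) : compact [set z : phase_space R n | `|z| <= r].
Proof.
have rVc : compact [set v : 'rV[R]_n | `|v| <= r].
  apply: bounded_closed_compact.
    by exists r; split; [exact: num_real | move=> M rM v /= vr; rewrite (le_trans vr)// ltW].
  apply: (@closed_comp _ _ (fun v : 'rV[R]_n => `|v|) [set x | x <= r]).
    by move=> v _; exact: norm_continuous.
  exact: closed_le.
rewrite (_ : [set z | _] = [set v | `|v| <= r] `*` [set v | `|v| <= r]).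
  exact: compact_setX.
by apply/seteqP; split => z /=; rewrite ler_pair_norm => /andP.
Qed.

Lemma continuous_bounded_on_balls (f : phase_space R n -> R) (r : R) : continuous f ->
  exists2 K, 0 <= K & forall z, `|z| <= r -> `|f z| <= K.
Proof.
move=> fc; have /compact_bounded[M [_ MP]] : compact (f @` [set z | `|z| <= r]).
  apply: continuous_compact; last exact: phase_space_ball_compact.
  exact: continuous_subspaceT.
exists (`|M| + 1) => [|z zr]; first by rewrite addr_ge0.
by apply: (MP (`|M| + 1)); [have := ler_norm M; lra | exists z].
Qed.

End phase_space_coordinates.

Section smooth_functions.
Variables (R : realType) (n : nat) (G : phase_space R n -> R).
Hypothesis G_smooth : smooth G.

Lemma smooth_differentiable z : differentiable G z.
Proof. by case: (G_smooth 1%N) => Gd _; apply: Gd. Qed.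

Lemma smooth_derive v : smooth ('D_v G).
Proof. by move=> k; case: (G_smooth k.+1) => _ GD; apply: GD. Qed.

Lemma diff_coordinates z u :
  'd G z u = \sum_i coordinate i u * 'D_(coordinate_vector R i) G z.
Proof.
rewrite {1}(sum_coordinates u) linear_sum; apply: eq_bigr => i _.
rewrite linearZ/= deriveE//; exact: smooth_differentiable.
Qed.

Lemma smooth_diff_bounded r : exists2 K, 0 <= K & forall z u,
  `|z| <= r -> `|'d G z u| <= K * `|u|.
Proof.
have b i : {K : R | 0 <= K & forall z, `|z| <= r ->
    `|'D_(coordinate_vector R i) G z| <= K}.
  by apply/cid2/continuous_bounded_on_balls; exact: (smooth_derive _ 0%N).
exists (\sum_i s2val (b i)) => [|z u zr]; first by apply: sumr_ge0 => i _; case: (b i).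
rewrite diff_coordinates mulr_suml (le_trans (ler_norm_sum _ _ _))//.
apply: ler_sum => i _; rewrite normrM mulrC.
by case: (b i) => K /= K0 KP; apply: ler_pM => //; [exact: KP | exact: coordinate_le].
Qed.

Lemma smooth_lipschitz r : exists2 K, 0 <= K & forall x y,
  `|x| <= r -> `|y| <= r -> `|G x - G y| <= K * `|x - y|.
Proof.
have [K K0 KP] := smooth_diff_bounded r; exists K => // x y xr yr.
have Gd s : is_derive s (1 : R) (fun s => G (y + s *: (x - y)))
    ('d G (y + s *: (x - y)) (x - y)).
  apply: is_derive_line; split; last by rewrite deriveE//; exact: smooth_differentiable.
  by apply: diff_derivable; exact: smooth_differentiable.
have := mean_value_unit (fun s _ => Gd s).
rewrite scale1r scale0r addr0 subrKC; apply => s s01.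
by apply: KP; exact: segment_bounded.
Qed.

End smooth_functions.

(** The partial derivatives of [G] are themselves smooth, so [smooth_lipschitz] applies to each of
    them. *)
Lemma smooth_diff_lipschitz (R : realType) (n : nat) (G : phase_space R n -> R) (r : R) :
  smooth G -> exists2 K, 0 <= K & forall z z' u, `|z| <= r -> `|z'| <= r ->
  `|'d G z u - 'd G z' u| <= K * `|z - z'| * `|u|.
Proof.
move=> Gs.
have b i : {K : R | 0 <= K & forall x y, `|x| <= r -> `|y| <= r ->
    `|'D_(coordinate_vector R i) G x - 'D_(coordinate_vector R i) G y| <= K * `|x - y|}.
  by apply/cid2/smooth_lipschitz/smooth_derive.
exists (\sum_i s2val (b i)) => [|z z' u zr zr']; first by apply: sumr_ge0 => i _; case: (b i).
have -> : 'd G z u - 'd G z' u = \sum_i coordinate i u *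
    ('D_(coordinate_vector R i) G z - 'D_(coordinate_vector R i) G z').
  transitivity (\sum_i coordinate i u * 'D_(coordinate_vector R i) G z
      - \sum_i coordinate i u * 'D_(coordinate_vector R i) G z').
    by congr (_ - _); exact: diff_coordinates.
  by rewrite -[LHS]sumrB; apply: eq_bigr => i _; rewrite [RHS]mulrBr.
apply: le_trans (ler_norm_sum _ _ _) _; rewrite [leRHS]mulrAC -mulrA mulr_suml.
apply: ler_sum => i _; rewrite normrM mulrA mulrAC.
case: (b i) => K /= K0 KP; rewrite [leLHS]mulrC -mulrA [leRHS]mulrA.
by apply: ler_pM => //; [exact: KP | exact: coordinate_le].
Qed.

Section smooth_vector_fields.
Variables (R : realType) (n : nat) (X : phase_space R n -> phase_space R n).
Hypothesis X_smooth : forall i, smooth (fun z => coordinate i (X z)).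

Lemma vector_field_differentiable z : differentiable X z.
Proof.
have -> : X = \sum_i (fun z => coordinate i (X z) *: coordinate_vector R i).
  by apply/funext => z'; rewrite fct_sumE; exact: sum_coordinates.
apply: differentiable_sum => i; apply: differentiableZl.
exact: smooth_differentiable (X_smooth i) z.
Qed.

(** Both sides are the derivative at 0 of the same real curve. The base point is written
    [z + 0 *: u] to fit [is_derive_line]. *)
Lemma coordinate_diff i z u :
  coordinate i ('d X z u) = 'd (fun z => coordinate i (X z)) z u.
Proof.
have dX : is_derive (z + (0 : R) *: u) u X ('d X z u).
  rewrite scale0r addr0; split; last by rewrite deriveE//; exact: vector_field_differentiable.
  by apply: diff_derivable; exact: vector_field_differentiable.
have dXi : is_derive (z + (0 : R) *: u) u (fun z => coordinate i (X z))
    ('d (fun z => coordinate i (X z)) z u).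
  rewrite scale0r addr0; split; last first.
    by rewrite deriveE//; exact: smooth_differentiable (X_smooth i) z.
  by apply: diff_derivable; exact: smooth_differentiable (X_smooth i) z.
have cX := @is_derive1_linear _ _ _ (coordinate i) 1 _ _ _ (coordinateB i)
  (coordinateZ i) _ (is_derive_line dX).
have [_ <-] := is_derive_line dXi.
have [|_ <-] := cX; last by [].
by move=> a; rewrite mul1r; exact: coordinate_le.
Qed.

Lemma vector_field_diff_bounded r : exists K, forall z u,
  `|z| <= r -> `|'d X z u| <= K * `|u|.
Proof.
have b i := cid2 (smooth_diff_bounded (X_smooth i) r).
have K0 : 0 <= \sum_i s2val (b i) by apply: sumr_ge0 => i _; case: (b i).
exists (\sum_i s2val (b i)) => z u zr; apply: norm_le_coordinates; first exact: mulr_ge0.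
move=> i; rewrite coordinate_diff (bigD1 i)//= mulrDl.
apply: ler_wpDr; last by case: (b i) => K /= _; exact.
by rewrite mulr_ge0// sumr_ge0// => j _; case: (b j).
Qed.

Lemma vector_field_diff_lipschitz r : exists K, forall z z' u,
  `|z| <= r -> `|z'| <= r -> `|'d X z u - 'd X z' u| <= K * `|z - z'| * `|u|.
Proof.
have b i := cid2 (smooth_diff_lipschitz r (X_smooth i)).
have K0 : 0 <= \sum_i s2val (b i) by apply: sumr_ge0 => i _; case: (b i).
exists (\sum_i s2val (b i)) => z z' u zr zr'.
apply: norm_le_coordinates; first by rewrite !mulr_ge0.
move=> i; have -> : coordinate i ('d X z u - 'd X z' u) =
    'd (fun z => coordinate i (X z)) z u - 'd (fun z => coordinate i (X z)) z' u.
  by rewrite coordinateB; congr (_ - _); exact: coordinate_diff.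
have bK : s2val (b i) <= \sum_i s2val (b i).
  by rewrite (bigD1 i)//= ler_wpDr// sumr_ge0// => j _; case: (b j).
apply: le_trans (s2valP' (b i) z z' u zr zr') _.
by rewrite !ler_wpM2r.
Qed.

End smooth_vector_fields.

Lemma smoothN (R : realType) (V : normedModType R) (f : V -> R) : smooth f -> smooth (- f).
Proof.
move=> fs k; have {fs} := fs k; elim: k f => [f fc z|k IH f [fd fD]] /=.
  by apply: cvgN; exact: fc.
split=> [z|v]; first by apply: differentiableN; exact: fd.
rewrite (_ : 'D_v (- f) = - 'D_v f); first by apply: IH; exact: fD.
by apply/funext => z; apply: deriveN; apply: diff_derivable; exact: fd.
Qed.

(** * Hamiltonian vector fields *)

Section hamiltonian_vector_field.
Variables (R : realType) (n : nat) (H : phase_space R n -> R).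
Variable X : phase_space R n -> phase_space R n.
Hypotheses (H_smooth : smooth H) (X_hamiltonian : is_hamiltonian_vector_field H X).

Lemma hamiltonian_x z j : (X z).1 0 j = 'd H z (0, delta_mx 0 j).
Proof.
rewrite X_hamiltonian /omega_std (bigD1 j)//= big1 => [|k kj]; rewrite !mxE/= ?eqxx.
  by rewrite mulr1 mulr0 subr0 addr0.
by rewrite (negPf kj) !mulr0 subr0.
Qed.

Lemma hamiltonian_y z j : (X z).2 0 j = - 'd H z (delta_mx 0 j, 0).
Proof.
rewrite X_hamiltonian /omega_std (bigD1 j)//= big1 => [|k kj]; rewrite !mxE/= ?eqxx.
  by rewrite mulr1 mulr0 sub0r addr0 opprK.
by rewrite (negPf kj) !mulr0 subr0.
Qed.

Lemma hamiltonian_smooth i : smooth (fun z => coordinate i (X z)).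
Proof.
rewrite /coordinate; case: fintype.split => j.
  rewrite (_ : (fun z => _) = 'D_((0, delta_mx 0 j) : phase_space R n) H).
    exact: smooth_derive.
  by apply/funext => z; rewrite hamiltonian_x deriveE//; exact: smooth_differentiable.
rewrite (_ : (fun z => _) = - 'D_((delta_mx 0 j, 0) : phase_space R n) H).
  exact/smoothN/smooth_derive.
apply/funext => z; rewrite hamiltonian_y.
rewrite -[RHS]/(- ('D_((delta_mx 0 j, 0) : phase_space R n) H z)).
by rewrite deriveE//; exact: smooth_differentiable.
Qed.

Lemma hamiltonian_gradient_y z : (X z).1 = gradient_y H z.1 z.2.
Proof.
apply/rowP => j; rewrite hamiltonian_x !mxE -deriveE; last exact: smooth_differentiable.
apply: (f_equal (fun f : R -> R => lim (f @ 0^'))); apply/funext => h.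
congr (_ *: (H _ - H _)); last by case: z.
by rewrite /shift/= -[LHS]/(h *: 0 + z.1, h *: delta_mx 0 j + z.2) scaler0 add0r.
Qed.

Variable p : R.
Hypothesis H_homogeneous : forall (x y : 'rV[R]_n) (lambda : R), 0 < lambda ->
  H (x, lambda *: y) = lambda `^ p * H (x, y).

Definition fiber_scale (k : R) (z : phase_space R n) : phase_space R n := (z.1, k *: z.2).

Lemma diff_fiber_scale k z v : 0 < k ->
  'd H (fiber_scale k z) (fiber_scale k v) = k `^ p * 'd H z v.
Proof.
move=> k0.
have dH w u : is_derive (w + (0 : R) *: u) u H ('d H w u).
  rewrite scale0r addr0; split; last by rewrite deriveE//; exact: smooth_differentiable.
  by apply: diff_derivable; exact: smooth_differentiable.
have [_ E1] := is_derive_line (dH (fiber_scale k z) (fiber_scale k v)).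
have [_ E2] := is_deriveZ (k `^ p) (is_derive_line (dH z v)).
apply: (eq_trans (esym E1)); apply: (eq_trans _ E2).
apply: (f_equal (fun f : R -> R => 'D_1 f 0)); apply/funext => s.
rewrite -[RHS]/(k `^ p * H (z + s *: v)) [z + _]surjective_pairing -H_homogeneous//.
congr H; rewrite /fiber_scale -[LHS]/(z.1 + s *: v.1, k *: z.2 + s *: (k *: v.2)).
by congr (_, _); rewrite /= scalerDr !scalerA mulrC.
Qed.

(** [fiber_scale k] is conformally symplectic with factor [k] while [dH] scales by [k^p], so the
    quotient [k^(p-1)] is left for the field; the proof checks this coordinate by coordinate. *)
Lemma hamiltonian_fiber_scale k z : 0 < k ->
  X (fiber_scale k z) = k `^ (p - 1) *: fiber_scale k (X z).
Proof.
move=> k0; have kE : k `^ (p - 1) * k = k `^ p.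
  by rewrite -{2}(powRr1 (ltW k0)) -powRD ?subrK// (gt_eqF k0) implybT.
have kn0 : k != 0 by rewrite gt_eqF.
rewrite [LHS]surjective_pairing; congr (_, _); apply/rowP => j; rewrite !mxE.
  rewrite !hamiltonian_x; apply: (mulIf kn0); rewrite mulrAC kE -diff_fiber_scale//.
  rewrite mulrC -[k * _]/(k *: _) -linearZ; congr ('d H _ _).
  by rewrite /fiber_scale/= -[LHS]/(k *: 0, k *: delta_mx 0 j) scaler0.
rewrite !hamiltonian_y mulrA kE mulrN -diff_fiber_scale//; congr (- 'd H _ _).
by rewrite /fiber_scale/= scaler0.
Qed.

End hamiltonian_vector_field.

(** * Derivatives of the Hamiltonian time-1 map *)

Lemma is_derive1_reparametrize (R : realType) (V : normedModType R) (c : R -> V)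
    (m : R -> R) (s a : R) (v : V) :
  is_derive s (1 : R) m a -> is_derive (m s) (1 : R) c v ->
  is_derive s (1 : R) (c \o m) (a *: v).
Proof.
move=> [md ma] [cd cv].
have {}md := (derivable1_diffP _ _).1 md; have {}cd := (derivable1_diffP _ _).1 cd.
have cmd := differentiable_comp md cd.
split; first exact/derivable1_diffP.
rewrite deriveE// diff_comp//= -(deriveE _ md) ma -[a in LHS]mulr1 -[a * 1]/(a *: 1).
by rewrite linearZ -deriveE// cv.
Qed.

Lemma is_diff_quadratic (R : realType) (V W : normedModType R) (f : V -> W)
    (df : {linear V -> W}) (x : V) (K d : R) : continuous df -> 0 < d ->
  (forall h, `|h| < d -> `|f (x + h) - f x - df h| <= K * `|h| ^+ 2) -> is_diff x f df.
Proof.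
move=> dfc d0 fx.
have fo : f \o shift x = cst (f x) + df +o_ 0 id.
  apply/eqaddoP => e e0; have K0 : 0 < `|K| + 1 by rewrite ltr_wpDl.
  apply/nbhs_ballP; exists (Num.min d (e / (`|K| + 1))) => /= [|h].
    by rewrite lt_min d0 divr_gt0.
  rewrite -ball_normE /= sub0r normrN lt_min => /andP[/fx hd].
  rewrite ltr_pdivlMr// => he.
  have -> : (f \o shift x - (cst (f x) + df)) h = f (x + h) - f x - df h.
    by rewrite -[LHS]/(f (h + x) - (f x + df h)) opprD addrA [h + x]addrC.
  apply: le_trans hd _; rewrite expr2 mulrA ler_wpM2r//.
  apply: le_trans (ltW he); rewrite mulrC ler_wpM2l//.
  by rewrite (le_trans (ler_norm _))// lerDl.
have dE := diff_unique dfc fo.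
by split=> //; apply/diff_locallyP; rewrite dE.
Qed.

Lemma mulmxr_continuous (R : realType) (m n : nat) (M : 'M[R]_(m, n)) :
  continuous (mulmxr M : 'rV[R]_m -> 'rV[R]_n).
Proof.
have -> : (mulmxr M : 'rV[R]_m -> 'rV[R]_n) =
    \sum_i (fun u : 'rV[R]_m => u 0 i *: row i M).
  by apply/funext => u; rewrite fct_sumE /= mulmx_sum_row.
move=> u; apply: differentiable_continuous; apply: differentiable_sum => i.
by apply: differentiableZl; exact: differentiable_coord.
Qed.

Lemma sum_pair (U V : nmodType) (I : finType) (F : I -> U) (G : I -> V) :
  \sum_i (F i, G i) = (\sum_i F i, \sum_i G i).
Proof.
rewrite [LHS]surjective_pairing; congr (_, _).
  by rewrite (big_morph fst (id1 := 0) (op1 := +%R)).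
by rewrite (big_morph snd (id1 := 0) (op1 := +%R)).
Qed.

Section hamiltonian_flow.
Variables (R : realType) (n : nat) (H : phase_space R n -> R).
Variable X : phase_space R n -> phase_space R n.
Hypotheses (H_smooth : smooth H) (X_hamiltonian : is_hamiltonian_vector_field H X).

Let X_smooth := hamiltonian_smooth H_smooth X_hamiltonian.
Let X_diff := vector_field_differentiable X_smooth.
Let dX_bounded := vector_field_diff_bounded X_smooth.
Let dX_lipschitz := vector_field_diff_lipschitz X_smooth.
Let pV := has_primitives_pair (@has_primitives_rV R n) (@has_primitives_rV R n).
Let cV := geometrically_complete_pair
  (@geometrically_complete_rV R n) (@geometrically_complete_rV R n).
Let phiX (z : phase_space R n) := (flow X 1 z).1.

Lemma hamiltonian_flowE (z w : phase_space R n) : flows_to X 1 z w -> flow X 1 z = w.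
Proof. exact: (flowE X_diff dX_bounded dX_lipschitz ler01). Qed.

Lemma flow_differentiable_y (x y : 'rV[R]_n) : flow_domain X 1 (x, y) ->
  differentiable (fun y' => phiX (x, y')) y.
Proof.
move=> [z [a [b [c [a0b a1b cX c0 c1]]]]].
have cd (t : R) : t \in `[0, 1] -> is_derive t (1 : R) c (X (c t)).
  move=> /[!in_itv]/= /andP[t0 t1]; apply: cX.
  move: a0b a1b; rewrite !in_itv/= => /andP[a0 _] /andP[_ b1].
  by rewrite (lt_le_trans a0)// (le_lt_trans t1).
have [K [d d0 dP]] := flow_linearization X_diff dX_bounded dX_lipschitz pV cV cd.
have w j := cid2 (variational_solution X_diff dX_bounded dX_lipschitz pV cV
  (0, delta_mx 0 j) cd).
(* Row [j] is the expected image of the [j]-th basis vector, matching the action of the Jacobian on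
   row vectors from the right. *)
pose M : 'M[R]_n := \matrix_j (s2val (w j) 1).1.
suff : is_diff y (fun y' => phiX (x, y')) (mulmxr M) by case.
apply: (is_diff_quadratic (K := K) (@mulmxr_continuous _ _ _ M) d0) => k kd.
(* By linearity of the variational equation this is a solution starting at [(0, k)], and the
   [x]-component of its value at time 1 is [k *m M]. *)
pose W (t : R) := \sum_j k 0 j *: s2val (w j) t.
have kn : `|((0, k) : phase_space R n)| = `|k|.
  by rewrite prod_normE normr0 max_r.
have [|||z' fz' z'P] := dP (0, k) W.
- by rewrite kn.
- rewrite /W (eq_bigr (fun j => (0, k 0 j *: delta_mx 0 j))) => [|j _].
    by rewrite sum_pair -row_sum_delta big1.
  by rewrite (s2valP (w j)) -[LHS]/(_ *: 0, _) scaler0.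
- move=> t t01.
  have -> : 'd X (c t) (W t) = \sum_j k 0 j *: 'd X (c t) (s2val (w j) t).
    by apply: etrans (linear_sum _ _ _ _) _; apply: eq_bigr => j _; exact: linearZ.
  rewrite /W.
  rewrite (_ : (fun t => _) = \sum_j k 0 j \*: s2val (w j)); last first.
    by apply/funext => s; rewrite fct_sumE.
  exact: is_derive_sum (fun j => is_deriveZ (k 0 j) (s2valP' (w j) t t01)).
rewrite c0 -[X in flows_to _ _ X]/(x + 0, y + k) addr0 in fz'.
rewrite /phiX (hamiltonian_flowE fz') (_ : flow X 1 (x, y) = c 1); last first.
  by apply: hamiltonian_flowE; exists a, b, c.
have kM : k *m M = (W 1).1.
  have -> : W 1 = (\sum_j k 0 j *: (s2val (w j) 1).1, \sum_j k 0 j *: (s2val (w j) 1).2).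
    by rewrite -sum_pair.
  by rewrite mulmx_sum_row; apply: eq_bigr => j _; rewrite rowK.
rewrite -[X in _ - X]/(k *m M) kM; rewrite kn in z'P; apply: le_trans z'P.
by have := lexx `|z' - c 1 - W 1|; rewrite ler_pair_norm => /andP[].
Qed.

Variable p : R.
Hypothesis H_homogeneous : forall (x y : 'rV[R]_n) (lambda : R), 0 < lambda ->
  H (x, lambda *: y) = lambda `^ p * H (x, y).

Lemma flow_fiber_scale (a b : R) (c : R -> phase_space R n) (k : R) :
  0 \in `]a, b[ -> integral_curve X a b c -> 0 < k -> k `^ (p - 1) < b ->
  flows_to X 1 (fiber_scale k (c 0)) (fiber_scale k (c (k `^ (p - 1)))).
Proof.
rewrite in_itv/= => /andP[a0 b0] cX k0 kb; set mu := k `^ (p - 1).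
have mu0 : 0 < mu by exact: powR_gt0.
(* The assumption [k^(p-1) < b] is what puts time 1 inside the rescaled interval. *)
exists (a / mu), (b / mu), (fun t => fiber_scale k (c (mu * t + 0))).
rewrite mulr0 mulr1 !addr0; split => //.
- by rewrite in_itv/= ltr_pdivrMr// mul0r a0 divr_gt0.
- rewrite in_itv/= ltr_pdivrMr// mul1r (lt_trans a0 mu0).
  by rewrite ltr_pdivlMr// mul1r.
move=> t; rewrite in_itv/= ltr_pdivrMr// ltr_pdivlMr// => /andP[at' tb].
have ct : is_derive (mu * t + 0) (1 : R) c (X (c (mu * t + 0))).
  by apply: cX; rewrite in_itv/= addr0 mulrC at' tb.
have -> : X (fiber_scale k (c (mu * t + 0))) = fiber_scale k (mu *: X (c (mu * t + 0))).
  rewrite (hamiltonian_fiber_scale H_smooth X_hamiltonian H_homogeneous)// -/mu.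
  move: (X (c _)) => v.
  by rewrite -[LHS]/(mu *: v.1, mu *: (k *: v.2)) /fiber_scale/= !scalerA mulrC.
apply: (@is_derive1_linear _ _ _ (fiber_scale k) (1 + k)) (is_derive1_comp_scale ct).
- by move=> u v; rewrite -[RHS]/(u.1 - v.1, k *: u.2 - k *: v.2) -scalerBr.
- by move=> l u; rewrite -[RHS]/(l *: u.1, l *: (k *: u.2)) /fiber_scale/= !scalerA mulrC.
- move=> u; have := lexx `|u|; rewrite ler_pair_norm => /andP[u1 u2].
  rewrite ler_pair_norm /= normrZ gtr0_norm// mulrDl mul1r.
  have ku : k * `|u.2| <= k * `|u| by rewrite ler_pM2l.
  have ku0 : 0 <= k * `|u.2| by rewrite mulr_ge0// ltW.
  by have := normr_ge0 u => u0; apply/andP; split; lra.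
Qed.

(* Scaling the fiber by [k] rescales time by [k `^ (p - 1)], so moving [y]
   radially moves the end point of the curve along the curve itself. *)
Lemma derive_flow_radial (x y : 'rV[R]_n) : flow_domain X 1 (x, y) ->
  is_derive (0 : R) (1 : R) (fun s => phiX (x, y + s *: y))
    ((p - 1) *: (X (flow X 1 (x, y))).1).
Proof.
move=> [z fz]; rewrite (hamiltonian_flowE fz).
case: fz => a [b [c [a0b a1b cX c0 <-]]].
pose m (s : R) := (1 * s + 1) `^ (p - 1).
have m0 : m 0 = 1 by rewrite /m mulr0 add0r powR1.
have md : is_derive (0 : R) (1 : R) m (p - 1).
  have P := @is_derive1_powR R (p - 1) 1 ltr01.
  have := @is_derive1_comp_scale _ _ (fun r : R => r `^ (p - 1)) 1 1 0 _ _.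
  rewrite mulr0 add0r => /(_ _ P); rewrite powR1 scale1r mulr1; exact.
have b1 : 0 < b - m 0 by move: a1b; rewrite m0 in_itv subr_gt0 => /andP[].
have /cvgrPdist_lt/(_ _ b1)[d /= d0 dP] := is_derive1_continuous md.
have cmd : is_derive (0 : R) (1 : R) (fun s => (c (m s)).1) ((p - 1) *: X (c 1)).1.
  apply: is_derive1_fst; apply: is_derive1_reparametrize => //.
  by rewrite m0; apply: cX.
apply: near_eq_is_derive cmd.
(* Radius [d] keeps the rescaled time [m s] below [b], where [c] is still an integral curve; radius
   1 keeps the scaling factor [1 + s] positive. *)
exists (Num.min d 1) => /= [|s]; first by rewrite lt_min d0 ltr01.
rewrite /ball_ /= sub0r normrN lt_min => /andP[sd s1].
have s1' : 0 < 1 + s by move: s1; rewrite ltr_norml => /andP[]; lra.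
have mE : m s = (1 + s) `^ (p - 1) by rewrite /m mul1r addrC.
have mb : (1 + s) `^ (p - 1) < b.
  have := dP s; rewrite /ball_/= sub0r normrN => /(_ sd).
  by rewrite distrC => /(le_lt_trans (ler_norm _)); rewrite ltrD2r mE.
have := hamiltonian_flowE (flow_fiber_scale a0b cX s1' mb).
by rewrite /phiX c0 /fiber_scale /= scalerDl scale1r => ->; rewrite mE.
Qed.

End hamiltonian_flow.

Theorem proposition3p10 (R : realType) (n : nat) (n_ge1 : (1 <= n)%N)
    (H : phase_space R n -> R) (H_smooth : smooth H)
    (p : R) (p_neq1 : p != 1)
    (H_homogeneous : forall (x y : 'rV[R]_n) (lambda : R), 0 < lambda ->
       H (x, lambda *: y) = lambda `^ p * H (x, y))
    (H_nondegenerate : forall x y : 'rV[R]_n, y != 0 -> gradient_y H x y != 0)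
    (X_H : phase_space R n -> phase_space R n)
    (X_H_hamiltonian : is_hamiltonian_vector_field H X_H) :
  let phi := flow X_H 1 in
  let phiX := fun z => (phi z).1 in
  forall x y : 'rV[R]_n,
    flow_domain X_H 1 (x, y) -> (phi (x, y)).2 != 0 ->
    (dim_ker (jacobian_y phiX x y) <= n - 1)%N.
Proof.
move=> phi phiX x y xy phi_neq0.
have f_diff := flow_differentiable_y H_smooth X_H_hamiltonian xy.
have df : is_derive (y + (0 : R) *: y) y (fun y' => phiX (x, y'))
    (y *m jacobian_y phiX x y).
  rewrite scale0r addr0 /jacobian_y mul_rV_lin1.
  by split; [exact: diff_derivable | exact: deriveE].
(* [E1] and [E2] compute the same radial derivative, once through the Jacobian and once along the
   integral curve. *)
have [_ E1] := is_derive_line df.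
have [_ E2] := derive_flow_radial H_smooth X_H_hamiltonian H_homogeneous xy.
have yJ : y *m jacobian_y phiX x y != 0.
  rewrite -[X in X != 0]E1 [X in X != 0]E2 scaler_eq0 negb_or subr_eq0 p_neq1 /=.
  by rewrite (hamiltonian_gradient_y H_smooth X_H_hamiltonian) H_nondegenerate.
(* Rank-nullity: it remains to see that the Jacobian is nonzero. *)
rewrite /dim_ker mxrank_ker leq_sub2l// lt0n mxrank_eq0.
by apply: contraNneq yJ => ->; rewrite mulmx0.
Qed.
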